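(* The function $\lambda\mapsto\sigma_\lambda$ is continuous and strictly increasing in $\lambda\in(0,\frac12)$, and $$\lim_{\lambda\to0}\sigma_\lambda=0,\qquad \lim_{\lambda\to\frac12}\sigma_\lambda=1.$$
   Context: For $\lambda\in(0,\frac12)$ and $x\in\mathbb{R}$, $$\varphi_\lambda(x):=\int_0^{+\infty}y^{-2\lambda}\exp\left\{-\frac{(y-x)^2}{2}\right\}dy ,$$ and primes denote derivatives in $x$. For each $\lambda\in(0,\frac12)$, $x_1^\lambda<0$ denotes the unique negative number with $\varphi_\lambda''(x_1^\lambda)=0$, $z^\lambda>0$ denotes the unique positive number with $\varphi_\lambda''(z^\lambda)+\varphi_\lambda''(-z^\lambda)=0$ (existence and uniqueness hold), and $\sigma_\lambda:=-x_1^\lambda/z^\lambda$. *)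

(* Defs.v *)
From HB Require Import structures.
From mathcomp Require Import all_boot all_order all_algebra.
From mathcomp Require Import all_classical all_reals all_analysis.

Set Implicit Arguments.
Unset Strict Implicit.
Unset Printing Implicit Defensive.

Import Order.TTheory GRing.Theory Num.Theory.
Import numFieldNormedType.Exports.

Local Open Scope classical_set_scope.
Local Open Scope ring_scope.

Definition phi (R : realType) (l x : R) : R :=
  \int[@lebesgue_measure R]_(y in `]0, +oo[)
    (y `^ (- (2 * l)) * expR (- ((y - x) ^+ 2 / 2))).

(* [get A] is a chosen element of A, with an irrelevant default when A is
   empty. For 0 < l < 1/2 the two sets below are singletons, so [get] returns
   their unique element. *)
Definition x1 (R : realType) (l : R) : R :=
  get [set x : R | x < 0 /\ (phi l)^`(2)%classic x = 0].

Definition zpos (R : realType) (l : R) : R :=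
  get [set z : R | 0 < z /\ (phi l)^`(2)%classic z + (phi l)^`(2)%classic (- z) = 0].

Definition sigma (R : realType) (l : R) : R := - x1 l / zpos l.

(* Main.v *)
From HB Require Import structures.
Require Import Defs.
From mathcomp Require Import all_boot all_order all_algebra.
From mathcomp Require Import all_classical all_reals all_analysis.
From mathcomp Require Import measurable_realfun ring lra.
Import Order.TTheory GRing.Theory Num.Theory.
Import numFieldNormedType.Exports.
Local Open Scope classical_set_scope.
Local Open Scope ring_scope.

(* Put [a = 2 l], and let [mom p x] be the integral of
   [y `^ p * expR (- (y - x) ^+ 2 / 2)] over the positive half-line, so that
   [phi l = mom (- a)].  Integration by parts gives [phi'' + x phi' + a phi = 0].
   For a positive solution [f] of this equation with [f' 0 <= 0],
   [expR (x ^+ 2 / 2) * f''] is strictly increasing on the half-line, so [f'']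
   changes sign exactly once there.  Applied to [phi (- x)] and to
   [phi x + phi (- x)] this gives existence and uniqueness of [- x1] and [zpos].
   A correlation inequality shows that [mom (1 - a) / mom (- a)] decreases in
   [a], hence [- x1] increases; a Wronskian comparison of the even solutions
   shows that [zpos] decreases.  Finally [(1 - a) * phi''] extends continuously
   to [a = 0] and [a = 1], with values [- x * expR (- x ^+ 2 / 2)] and
   [(x ^+ 2 - 1) * expR (- x ^+ 2 / 2)]; convergence of these functions
   forces convergence of their sign changes, which gives continuity and both
   limits. *)

(** * Integrals over the positive half-line *)

(** The integrand may blow up at the origin, so the fundamental theorem is applied on [[1 / (n + 1),
    +oo[]. Since [f] is nonnegative, monotone convergence along these growing sets gives the whole
    half-line. *)
Lemma ge0_integral_derive_itv0y {R : realType} (f F : R -> R) (A B : R) :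
  (forall x : R, 0 < x -> 0 <= f x) ->
  (forall x : R, 0 < x -> is_derive x 1 F (f x)) ->
  (forall x : R, 0 < x -> {for x, continuous f}) ->
  F x @[x --> 0^'+] --> A -> F x @[x --> +oo] --> B ->
  (\int[@lebesgue_measure R]_(x in `]0%R, +oo[) (f x)%:E = (B - A)%:E)%E.
Proof.
move=> f0 dF cf FA FB.
pose D n := `[(n.+1%:R^-1 : R), +oo[%classic.
have gt0 n x : D n x -> 0 < x.
  by rewrite /D /= in_itv/= andbT => /(lt_le_trans _); apply; rewrite invr_gt0.
have DU : \bigcup_n D n = `]0, +oo[%classic.
  apply/seteqP; split=> [x [n _ /gt0 x0]|x]; rewrite /= in_itv/= andbT //.
  move=> x0; have [n nx] := ltr_add_invr x0.
  by exists n => //; rewrite /D /= in_itv/= andbT ltW // -[ltLHS]add0r.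
have cD n : {within D n, continuous f}.
  by apply: continuous_in_subspaceT => x /set_mem /gt0; exact: cf.
have mD n : measurable_fun (D n) f.
  apply: subspace_continuous_measurable_fun => //.
  exact: measurable_itv.
have cF x : 0 < x -> {for x, continuous F}.
  by move=> x0; apply: differentiable_continuous; apply/derivable1_diffP;
     have [] := dF _ x0.
have DE n : (\int[@lebesgue_measure R]_(x in D n) (f x)%:E =
    (B - F n.+1%:R^-1)%:E)%E.
  have n0 : 0 < n.+1%:R^-1 :> R by rewrite invr_gt0.
  rewrite (@ge0_continuous_FTC2y _ f F _ B) //.
  - by move=> x /(lt_le_trans n0); exact: f0.
  - exact: cD.
  - by move=> x /(lt_trans n0) x0; have [] := dF _ x0.
  - by apply: cvg_at_right_filter; exact: cF.
  - move=> x; rewrite in_itv/= andbT => /(lt_trans n0) x0.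
    by rewrite derive1E; have [] := dF _ x0.
have /cvg_lim <- // :
  ((\int[@lebesgue_measure R]_(x in D i) (f x)%:E)%E @[i --> \oo]
    --> (\int[@lebesgue_measure R]_(x in `]0%R, +oo[) (f x)%:E)%E).
  rewrite -DU; apply: ge0_nondecreasing_set_cvg_integral => //.
  - apply/nondecreasing_seqP => n; rewrite subsetEset.
    move=> x; rewrite /D /= !in_itv/= !andbT; apply: le_trans.
    by rewrite lef_pV2 ?posrE// ler_nat.
  - by move=> n; rewrite /D; exact: measurable_itv.
  - by move=> n; apply/measurable_EFinP; exact: mD.
  - by move=> n x /gt0 x0; rewrite lee_fin f0.
under eq_fun do rewrite DE.
apply/cvg_lim => //; apply: cvg_EFin; first exact: nearW.
apply: cvgB; first exact: cvg_cst.
have [+ _] := (cvg_at_rightP F 0 A); apply => //.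
split; first by move=> n; rewrite invr_gt0.
exact: cvg_harmonic.
Qed.

(* An integrable majorant of the kernel at both ends of the half-line, chosen for
   its closed-form primitive [(y / (1 + y)) `^ (q + 1) / (q + 1)]. *)
Definition dom {R : realType} (q y : R) : R := (y / (1 + y)) `^ q / (1 + y) ^+ 2.

Lemma is_derive_dom {R : realType} (q y : R) : 0 < q + 1 -> 0 < y ->
  is_derive y 1 (fun t : R => (t / (1 + t)) `^ (q + 1) / (q + 1)) (dom q y).
Proof.
move=> q0 y0; have y1 : 1 + y != 0 by rewrite gt_eqF// addr_gt0.
have u0 : 0 < y / (1 + y) by rewrite divr_gt0// addr_gt0.
have du : is_derive y 1 (fun t : R => t / (1 + t)) ((1 + y) ^- 2).
  have dV : is_derive y 1 (fun t : R => (1 + t)^-1) (- (1 + y) ^- 2 *: (1 : R)).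
    by apply: is_deriveV => //; apply: is_derive_eq; rewrite add0r.
  by apply: is_derive_eq; rewrite /GRing.scale/=; field.
have dp := @is_derive1_powR R (q + 1) _ u0.
have := @is_derive1_comp _ _ (fun t : R => t / (1 + t)) _ _ _ dp du.
move=> /(@is_deriveZ _ _ _ _ (q + 1)^-1).
rewrite /dom /GRing.scale /= addrK.
move=> dF.
rewrite (_ : (fun t : R => _) =
    (q + 1)^-1 \*: ((@powR R)^~ (q + 1) \o (fun t : R => t / (1 + t)))).
  by apply: (is_derive_eq dF); field; rewrite y1 gt_eqF.
by apply/funext => t; rewrite mulrC.
Qed.

Lemma continuous_dom {R : realType} (q y : R) : 0 < y -> {for y, continuous (dom q)}.
Proof.
move=> y0; have y1 : 1 + y != 0 by rewrite gt_eqF// addr_gt0.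
have u0 : 0 < y / (1 + y) by rewrite divr_gt0// addr_gt0.
have c1 : (fun t : R => 1 + t) @ y --> 1 + y by apply: cvgD; [exact: cvg_cst|].
apply: cvgM; last by apply: cvgV; [rewrite expf_neq0|apply: cvgM].
apply: (@continuous_cvg _ _ _ _ _ (fun t : R => t / (1 + t)) (fun t : R => t `^ q)).
  apply: differentiable_continuous; apply/derivable1_diffP.
  by apply: derivable_powR; rewrite in_itv/= andbT.
by apply: cvgM; [|exact: cvgV].
Qed.

Lemma cvg_dom_primitive_at0 {R : realType} (q : R) : 0 < q + 1 ->
  (t / (1 + t)) `^ (q + 1) / (q + 1) @[t --> (0 : R)^'+] --> (0 : R).
Proof.
move=> q0; rewrite -[X in _ --> X](mul0r (q + 1)^-1).
apply: cvgM; last exact: cvg_cst.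
apply: (@squeeze_cvgr _ _ _ _ (cst 0) (fun t : R => t `^ (q + 1))); last 2 first.
- exact: cvg_cst.
- exact: powR_cvg0.
near=> t; have t0 : 0 < t by near: t; exact: nbhs_right_gt.
have t1 : 0 < 1 + t by rewrite addr_gt0.
have ut : t / (1 + t) <= t.
  by rewrite ler_pdivrMr// mulrDr mulr1 lerDl mulr_ge0 ?ltW.
rewrite powR_ge0/=; apply: ge0_ler_powR => //; first exact: ltW.
  by rewrite nnegrE divr_ge0// ltW.
by rewrite nnegrE ltW.
Unshelve. all: by end_near. Qed.

Lemma cvg_dom_primitive_aty {R : realType} (q : R) : 0 < q + 1 ->
  (t / (1 + t)) `^ (q + 1) / (q + 1) @[t --> +oo] --> ((q + 1)^-1 : R).
Proof.
move=> q0; rewrite [X in _ --> X](_ : _ = 1 `^ (q + 1) / (q + 1)); last first.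
  by rewrite powR1 mul1r.
apply: cvgM; last exact: cvg_cst.
apply: (@continuous_cvg _ _ _ _ _ (fun t : R => t / (1 + t))
    (fun t : R => t `^ (q + 1))).
  apply: differentiable_continuous; apply/derivable1_diffP.
  by apply: derivable_powR; rewrite in_itv/= andbT.
have : (1 - (1 + t)^-1) @[t --> +oo] --> (1 - 0 : R).
  apply: cvgB; first exact: cvg_cst.
  apply/gtr0_cvgV0; last exact: cvg_addrl.
  by near=> t; rewrite addr_gt0//; near: t; exact: nbhs_pinfty_gt.
rewrite subr0; apply: cvg_trans; apply: near_eq_cvg; near=> t.
have t0 : 0 < t by near: t; exact: nbhs_pinfty_gt.
by field; rewrite gt_eqF// addr_gt0.
Unshelve. all: by end_near. Qed.

Lemma dom_ge0 {R : realType} (q y : R) : 0 <= dom q y.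
Proof. by rewrite divr_ge0 ?powR_ge0// sqr_ge0. Qed.

Lemma integral_dom {R : realType} (q : R) : 0 < q + 1 ->
  (\int[@lebesgue_measure R]_(y in `]0%R, +oo[) (dom q y)%:E = ((q + 1)^-1)%:E)%E.
Proof.
move=> q0; rewrite -[X in X%:E]subr0.
apply: (ge0_integral_derive_itv0y _ _ _ _ _ _ _ (cvg_dom_primitive_at0 _ q0)
  (cvg_dom_primitive_aty _ q0)).
- by move=> y _; exact: dom_ge0.
- by move=> y; exact: is_derive_dom.
- by move=> y; exact: continuous_dom.
Qed.

Lemma measurable_fun_cts0y {R : realType} (f : R -> R) :
  (forall x : R, 0 < x -> {for x, continuous f}) -> measurable_fun `]0%R : R, +oo[ f.
Proof.
move=> cf; apply: open_continuous_measurable_fun; first exact: interval_open.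
by move=> x; rewrite inE/= in_itv/= andbT; exact: cf.
Qed.

Lemma integrable_dom {R : realType} (q : R) : 0 < q + 1 ->
  (@lebesgue_measure R).-integrable `]0, +oo[ (EFin \o dom q).
Proof.
move=> q0; apply/integrableP; split.
  by apply/measurable_EFinP; apply: measurable_fun_cts0y => y; exact: continuous_dom.
under eq_integral do rewrite /= ger0_norm ?dom_ge0//.
by rewrite integral_dom// ltry.
Qed.

(** * Moments of the Gaussian kernel *)

Definition kern {R : realType} (p x y : R) : R :=
  y `^ p * expR (- ((y - x) ^+ 2 / 2)).

(* Locked: otherwise unification and [ring] unfold the integral when they
   compare moments with different exponents. *)
HB.lock Definition mom {R : realType} (p x : R) : R :=
  \int[@lebesgue_measure R]_(y in `]0, +oo[) kern p x y.

Lemma momE {R : realType} (p x : R) :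
  mom p x = \int[@lebesgue_measure R]_(y in `]0, +oo[) kern p x y.
Proof. by rewrite mom.unlock. Qed.

(** The constant of [kern_le_dom]: the factorial comes from a term of the exponential series, the
    exponent from completing squares. *)
Definition kern_bound {R : realType} (n : nat) (X : R) : R :=
  n.+2`!%:R * expR (X ^+ 2 / 2 + 2).

Lemma kern_ge0 {R : realType} (p x y : R) : 0 <= kern p x y.
Proof. by rewrite mulr_ge0 ?powR_ge0 ?expR_ge0. Qed.

Lemma kern_bound_ge0 {R : realType} n (X : R) : 0 <= kern_bound n X.
Proof. by rewrite mulr_ge0 ?expR_ge0. Qed.

Lemma kernS {R : realType} (p x y : R) : 0 < y ->
  kern (p + 1) x y = y * kern p x y.
Proof.
move=> y0; rewrite /kern powRD; last by rewrite (gt_eqF y0) implybT.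
by rewrite powRr1 ?(ltW y0)//; ring.
Qed.

(** Near the origin the smallest exponent [q] governs; at infinity the Gaussian beats
    [(1 + y) ^+ n.+2]. The bound is uniform in [p] and [x], as domination under the integral sign
    requires. *)
Lemma kern_le_dom {R : realType} n (X q p x y : R) : q <= p -> p <= n%:R ->
  `|x| <= X -> 0 < y -> kern p x y <= kern_bound n X * dom q y.
Proof.
move=> qp pn xX y0; have y1 : 0 < 1 + y by rewrite addr_gt0.
have powE (a z : R) : 0 < a -> a `^ z = expR (z * ln a).
  by move=> a0; rewrite /powR gt_eqF.
have lnyy : ln y <= ln (1 + y) by rewrite ler_ln ?posrE// lerDr.
have ln0 : 0 <= ln (1 + y) by rewrite ln_ge0// lerDl ltW.
(* In logarithms, right minus left is [(p - q) * (ln (1 + y) - ln y) + (n%:R - p) * ln (1 + y)]. *)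
have step1 : y `^ p <= (y / (1 + y)) `^ q * (1 + y) ^+ n.
  rewrite !powE ?divr_gt0// ln_div ?posrE//.
  rewrite -[X in _ <= _ * X ^+ n](@lnK _ (1 + y)) ?posrE// -expRM_natl.
  rewrite -expRD ler_expR.
  have := mulr_ge0 (_ : 0 <= p - q) (_ : 0 <= ln (1 + y) - ln y).
  have := mulr_ge0 (_ : 0 <= n%:R - p) ln0.
  by rewrite !subr_ge0 => /(_ pn) + /(_ qp lnyy); lra.
(* The two extra powers pay for the denominator of [dom]. The exponent [1 + y - (y - x) ^+ 2 / 2] is
   at most [x ^+ 2 / 2 + 2], because [y <= y ^+ 2 / 4 + 1] and [x * y <= y ^+ 2 / 4 + x ^+ 2]. *)
have step2 : (1 + y) ^+ n.+2 * expR (- ((y - x) ^+ 2 / 2)) <= kern_bound n X.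
  have h1 : (1 + y) ^+ n.+2 <= n.+2`!%:R * expR (1 + y).
    have := @expR_ge1Dxn R (1 + y) n.+1 (ltW y1).
    rewrite -ler_pdivrMl ?ltr0n ?fact_gt0// mulrC; apply: le_trans.
    by rewrite lerDr.
  apply: (le_trans (ler_wpM2r (expR_ge0 _) h1)).
  rewrite /kern_bound -mulrA -expRD ler_wpM2l// ler_expR.
  have : x ^+ 2 <= X ^+ 2 
    by rewrite -(real_normK (num_real x)) lerXn2r ?nnegrE// (le_trans _ xX).
  have := sqr_ge0 (y / 2 - 1); have := sqr_ge0 (y - 2 * x); nra.
rewrite /kern /dom; apply: (le_trans (ler_wpM2r (expR_ge0 _) step1)).
rewrite -[leLHS]mulrA [leRHS]mulrCA; apply: ler_wpM2l.
  exact: powR_ge0.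
rewrite ler_pdivlMr ?exprn_gt0//; apply: le_trans step2.
by rewrite mulrAC -exprD addn2.
Qed.

Lemma le_nat_bound {R : realType} (x : R) : exists n : nat, x <= n%:R.
Proof.
exists (Num.bound `|x|); rewrite (le_trans (ler_norm x))// ltW//.
exact: archi_boundP.
Qed.

Lemma continuous_kern {R : realType} (p x y : R) : 0 < y ->
  {for y, continuous (kern p x)}.
Proof.
move=> y0; have cp : {for y, continuous (fun t : R => t `^ p)}.
  apply: differentiable_continuous; apply/derivable1_diffP.
  by apply: derivable_powR; rewrite in_itv/= andbT.
apply: cvgM cp _.
apply: (@continuous_cvg _ _ _ _ _ (fun t : R => - ((t - x) ^+ 2 / 2)) expR).
  exact: continuous_expR.
apply: cvgN; apply: cvgM; last exact: cvg_cst.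
by apply: cvgM; apply: cvgB => //; exact: cvg_cst.
Qed.

Lemma le_dom_integrable {R : realType} (C q : R) (f : R -> R) : 0 < q + 1 ->
  (forall y : R, 0 < y -> {for y, continuous f}) ->
  (forall y : R, 0 < y -> `|f y| <= C * dom q y) ->
  (@lebesgue_measure R).-integrable `]0, +oo[ (EFin \o f).
Proof.
move=> q0 cf fC.
have mE : measurable (`]0%R, +oo[%classic : set (measurableTypeR R)).
  exact: measurable_itv.
refine (le_integrable mE (g := EFin \o (fun y => C * dom q y)) _ _ _) => //.
- by apply/measurable_EFinP; apply: measurable_fun_cts0y.
- move=> y; rewrite /= in_itv/= andbT => y0; rewrite lee_fin.
  by rewrite (le_trans (fC _ y0))// ler_norm.
- exact: (integrableZl mE C (integrable_dom _ q0)).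
Qed.

Lemma integrable_kern {R : realType} (p x : R) : 0 < p + 1 ->
  (@lebesgue_measure R).-integrable `]0, +oo[ (EFin \o kern p x).
Proof.
move=> p0; have [n pn] := le_nat_bound p.
apply: (le_dom_integrable (kern_bound n `|x|) p) => // y y0.
  exact: continuous_kern.
by rewrite ger0_norm ?kern_ge0//; exact: kern_le_dom.
Qed.

Lemma continuous_mom {R : realType} (p x : R) : 0 < p + 1 ->
  {for p, continuous (fun p => mom p x)}.
Proof.
move=> p0; under [X in {for _, continuous X}]eq_fun do rewrite momE.
(* The midpoint of [-1] and [p]: exponents near [p] stay above [u], and [dom u] is still
   integrable. *)
pose u := (p - 1) / 2; pose v := p + 1.
have [n vn] := le_nat_bound v.
have u1 : 0 < u + 1 by rewrite /u; lra.
apply: (@continuity_under_integral _ _ _ lebesgue_measure (fun p y => kern p x y)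
    _ _ u v _ _ (fun y => kern_bound n `|x| * dom u y)).
- exact: measurable_itv.
- move=> q; rewrite /= in_itv/= => /andP[uq _].
  by apply: integrable_kern; lra.
- apply/aeW => y; rewrite /= in_itv/= andbT => y0 q _.
  apply: cvgM; last exact: cvg_cst.
  rewrite /powR gt_eqF//.
  apply: (@continuous_cvg _ _ _ _ _ (fun q : R => q * ln y) expR).
    exact: continuous_expR.
  by apply: cvgM => //; exact: cvg_cst.
- apply: (le_dom_integrable (kern_bound n `|x|) u) => // y y0.
    by apply: cvgM; [exact: cvg_cst|exact: continuous_dom].
  by rewrite ger0_norm// mulr_ge0 ?dom_ge0 ?kern_bound_ge0.
- move=> q; rewrite /= in_itv/= => /andP[uq qv]; apply/aeW => y.
  rewrite /= in_itv/= andbT => y0.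
  rewrite ger0_norm ?kern_ge0//; apply: kern_le_dom => //; first exact: ltW.
  by rewrite ltW// (lt_le_trans qv).
- by rewrite inE/= in_itv/= /u /v; apply/andP; split; lra.
Qed.

(** Adding [C * dom q] makes the integrand nonnegative; its known primitive and integral are then
    subtracted. *)
Lemma Rintegral_derive_itv0y {R : realType} (C q : R) (f F : R -> R) (A B : R) :
  0 < q + 1 ->
  (forall y : R, 0 < y -> `|f y| <= C * dom q y) ->
  (forall y : R, 0 < y -> is_derive y 1 F (f y)) ->
  (forall y : R, 0 < y -> {for y, continuous f}) ->
  F y @[y --> 0^'+] --> A -> F y @[y --> +oo] --> B ->
  \int[@lebesgue_measure R]_(y in `]0, +oo[) f y = B - A.
Proof.
move=> q0 fC dF cf FA FB.
pose G y := F y + C * ((y / (1 + y)) `^ (q + 1) / (q + 1)).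
have mE : measurable (`]0%R, +oo[%classic : set (measurableTypeR R)).
  exact: measurable_itv.
have := @ge0_integral_derive_itv0y _ (fun y => f y + C * dom q y) G
  (A + C * 0) (B + C * (q + 1)^-1).
have If := le_dom_integrable _ _ _ q0 cf fC.
have Id := integrable_dom _ q0.
move=> /(_ _ _ _ _ _)/(congr1 fine) I.
have : \int[@lebesgue_measure R]_(y in `]0, +oo[) (f y + C * dom q y) =
    B + C / (q + 1) - (A + C * 0).
  apply: I.
  - by move=> y y0; have := fC _ y0; rewrite ler_norml => /andP[]; lra.
  - move=> y y0; apply: is_deriveD; first exact: dF.
    exact: is_deriveZ (is_derive_dom _ _ q0 y0).
  - move=> y y0; apply: cvgD; first exact: cf.
    by apply: cvgM; [exact: cvg_cst|exact: continuous_dom].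
  - apply: cvgD => //; apply: cvgM; first exact: cvg_cst.
    exact: cvg_dom_primitive_at0.
  - apply: cvgD => //; apply: cvgM; first exact: cvg_cst.
    exact: cvg_dom_primitive_aty.
rewrite RintegralD//; last exact: (integrableZl mE C Id).
by rewrite RintegralZl// {2}/Rintegral integral_dom//=; lra.
Qed.

Lemma is_derive_gauss {R : realType} (x y : R) :
  is_derive y 1 (fun t : R => expR (- ((t - x) ^+ 2 / 2)))
    (- (y - x) * expR (- ((y - x) ^+ 2 / 2))).
Proof.
have du : is_derive y 1 (fun t : R => - ((t - x) ^+ 2 / 2)) (- (y - x)).
  by apply: is_derive_eq; rewrite /GRing.scale/=; field.
have := @is_derive1_comp _ expR (fun t : R => - ((t - x) ^+ 2 / 2)) _ _ _
  (is_derive_expR _) du.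
by rewrite mulrC.
Qed.

Lemma is_derive_kern_shift {R : realType} (p x y : R) : 0 < y ->
  is_derive x 1 (fun t => kern p t y) (kern (p + 1) x y - x * kern p x y).
Proof.
move=> y0; rewrite (_ : (fun t => _) =
    y `^ p \*: (fun t : R => expR (- ((t - y) ^+ 2 / 2)))); last first.
  by apply/funext => t; rewrite /kern -(sqrrN (y - t)) opprB.
apply: (is_derive_eq (is_deriveZ _ (is_derive_gauss _ _))).
by rewrite kernS// /kern -(sqrrN (x - y)) opprB /GRing.scale/=; ring.
Qed.

Lemma is_derive_kern {R : realType} (r x y : R) : 0 < y ->
  is_derive y 1 (kern r x)
    (r * kern (r - 1) x y - kern (r + 1) x y + x * kern r x y).
Proof.
move=> y0; have dp := @is_derive1_powR _ r _ y0.
apply: (is_derive_eq (is_deriveM dp (is_derive_gauss x y))).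
by rewrite kernS// /kern /GRing.scale/=; ring.
Qed.

Lemma is_derive_mom {R : realType} (p x : R) : 0 < p + 1 ->
  is_derive x 1 (mom p) (mom (p + 1) x - x * mom p x).
Proof.
move=> p0; pose X := `|x| + 1.
have [n pn] := le_nat_bound (p + 1).
(* For [t] within distance 1 of [x], [|t| <= X], and both kernels in
   [kern (p + 1) t y - t * kern p t y] lie below [kern_bound n X * dom p y]. *)
pose D y := kern_bound n X * (1 + X) * dom p y.
have mE : measurable (`]0%R, +oo[%classic : set (measurableTypeR R)).
  exact: measurable_itv.
have X0 : 0 <= X by rewrite addr_ge0.
have C0 := kern_bound_ge0 n X.
have D0 y : 0 <= D y 
  by apply: mulr_ge0; [apply: mulr_ge0 => //; exact: addr_ge0|exact: dom_ge0].
have intD : (@lebesgue_measure R).-integrable `]0, +oo[ (EFin \o D).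
  by apply: (integrableZl mE _ (integrable_dom _ p0)).
have dE t y : 0 < y ->
    partial1of2 (fun t y => kern p t y) t y = kern (p + 1) t y - t * kern p t y.
  by move=> y0; rewrite partial1of2E; have [] := is_derive_kern_shift p t _ y0.
have Ia : `]x - 1, x + 1[%classic x by rewrite /= in_itv/=; apply/andP; split; lra.
have intk t : `]x - 1, x + 1[%classic t ->
    (@lebesgue_measure R).-integrable `]0, +oo[ (EFin \o kern p t).
  by move=> _; exact: integrable_kern.
have dk t (y : R) : `]x - 1, x + 1[%classic t -> `]0, +oo[%classic y ->
    derivable (kern p ^~ y) t 1.
  rewrite /= !in_itv/= andbT => _ y0.
  by have [] := is_derive_kern_shift p t _ y0.
have D_ub t (y : R) : `]x - 1, x + 1[%classic t -> `]0, +oo[%classic y ->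
    `|partial1of2 (fun t y => kern p t y) t y| <= D y.
  rewrite /= !in_itv/= andbT => /andP[t1 t2] y0; rewrite dE//.
  have tX : `|t| <= X.
    by have := ler_norm x; have := ler_norm (- x);
       rewrite /X normrN ler_norml; lra.
  apply: (le_trans (ler_normB _ _)).
  rewrite (ger0_norm (kern_ge0 (p + 1) t y)) normrM (ger0_norm (kern_ge0 p t y)).
  have k1 : kern (p + 1) t y <= kern_bound n X * dom p y.
    by apply: kern_le_dom => //; lra.
  have k2 : kern p t y <= kern_bound n X * dom p y by apply: kern_le_dom => //; lra.
  have := ler_pM (normr_ge0 t) (kern_ge0 p t y) tX k2.
  move=> h; rewrite /D (_ : _ * _ * _ = kern_bound n X * dom p y +
    X * (kern_bound n X * dom p y)); last by ring.
  exact: lerD.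
have := differentiation_under_integral mE Ia intk dk D0 intD D_ub.
have := derivable_under_integral mE Ia intk dk D0 intD D_ub.
move=> dm eqm; rewrite (funext (momE p)) momE; apply: DeriveDef => //.
rewrite -derive1E [LHS]eqm.
transitivity (\int[@lebesgue_measure R]_(y in `]0, +oo[)
    (kern (p + 1) x y - x * kern p x y)).
  by apply: eq_Rintegral => y; rewrite inE/= in_itv/= andbT => y0; rewrite dE.
rewrite RintegralB//; last 2 first.
- by apply: integrable_kern; lra.
- exact: (integrableZl mE _ (integrable_kern _ _ p0)).
by rewrite RintegralZl//; exact: integrable_kern.
Qed.

Lemma cvg_kern_at0 {R : realType} (r x : R) : 0 <= r ->
  kern r x y @[y --> (0 : R)^'+] --> (r == 0)%:R * expR (- (x ^+ 2 / 2)).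
Proof.
move=> r0; apply: (@cvg_trans _ ((y `^ r * expR (- ((y - x) ^+ 2 / 2)))
   @[y --> (0 : R)^'+])) => //.
apply: cvgM; last first.
  rewrite (_ : x ^+ 2 = (0 - x) ^+ 2); last by ring.
  apply: cvg_at_right_filter.
  have : {for 0, continuous (fun y : R => expR (- ((y - x) ^+ 2 / 2)))} => //.
  apply: differentiable_continuous; apply/derivable1_diffP.
  by have [] := is_derive_gauss x 0.
have [->|rN0] := eqVneq r 0.
  by under eq_fun do rewrite powRr0; exact: cvg_cst.
by apply: powR_cvg0; rewrite lt_neqAle eq_sym rN0.
Qed.

(** Even with one more power of [y] the kernel stays bounded, since [dom 0 <= 1]; hence it is
    [O(1 / y)]. *)
Lemma cvg_kern_aty {R : realType} (r x : R) : 0 <= r ->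
  kern r x y @[y --> +oo] --> (0 : R).
Proof.
move=> r0; have [n rn] := le_nat_bound (r + 1).
have C0 := kern_bound_ge0 n `|x|.
apply: (@squeeze_cvgr _ _ _ _ (cst 0) (fun y => kern_bound n `|x| * y^-1)).
- near=> y; have y0 : 0 < y by near: y; exact: nbhs_pinfty_gt.
  rewrite kern_ge0/= ler_pdivlMr// mulrC -kernS//.
  apply: (le_trans (kern_le_dom n `|x| 0 _ _ _ _ rn (lexx _) y0)); first lra.
  rewrite ler_piMr// /dom powRr0 mul1r invf_le1 ?exprn_gt0 ?addr_gt0//.
  by rewrite exprn_ege1// lerDl ltW.
- exact: cvg_cst.
- rewrite -[X in _ --> X](mulr0 (kern_bound n `|x|)).
  apply: cvgM; first exact: cvg_cst.
  apply/gtr0_cvgV0; last exact: cvg_id.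
  by near=> y; near: y; exact: nbhs_pinfty_gt.
Unshelve. all: by end_near. Qed.

(** Integration by parts: the derivative of [kern r x] is integrated over the half-line. The
    boundary value at the origin survives exactly when [r = 0], and there the factor [r] annihilates
    [mom (- 1)], whose integral diverges. *)
Lemma mom_recurrence {R : realType} (r x : R) : 0 <= r ->
  mom (r + 1) x - x * mom r x =
  r * mom (r - 1) x + (r == 0)%:R * expR (- (x ^+ 2 / 2)).
Proof.
move=> r0; have mE : measurable (`]0%R, +oo[%classic : set (measurableTypeR R)).
  exact: measurable_itv.
have [n rn] := le_nat_bound (r + 1).
(* The lowest exponent really present: at [r = 0] the term in [r - 1] vanishes, and [dom (- 1)]
   would not be integrable. *)
pose q := if r == 0 then 0 else r - 1.
have [q0 qr] : 0 < q + 1 /\ q <= r.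
  rewrite /q; case: eqVneq => [|rN0]; first lra.
  have : 0 < r by rewrite lt_neqAle eq_sym rN0.
  by lra.
have ik : (@lebesgue_measure R).-integrable `]0, +oo[
    (EFin \o (fun y => r * kern (r - 1) x y)).
  have [->|rN0] := eqVneq r 0.
    rewrite (_ : EFin \o _ = cst 0%E) ?integrable0//.
    by apply/funext => y; rewrite /= mul0r.
  have rgt0 : 0 < r by rewrite lt_neqAle eq_sym rN0.
  by apply: (integrableZl mE _ (integrable_kern _ _ _)); lra.
have i1 : (@lebesgue_measure R).-integrable `]0, +oo[ (EFin \o kern (r + 1) x).
  by apply: integrable_kern; lra.
have i0 : (@lebesgue_measure R).-integrable `]0, +oo[ (EFin \o kern r x).
  by apply: integrable_kern; lra.
have ix : (@lebesgue_measure R).-integrable `]0, +oo[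
    (EFin \o (fun y => x * kern r x y)) by exact: (integrableZl mE _ i0).
have Ik : \int[@lebesgue_measure R]_(y in `]0, +oo[) (r * kern (r - 1) x y) =
    r * mom (r - 1) x.
  have [->|rN0] := eqVneq r 0.
    rewrite mul0r; under eq_Rintegral do rewrite mul0r.
    by rewrite Rintegral_cst// mul0r.
  have rgt0 : 0 < r by rewrite lt_neqAle eq_sym rN0.
  by rewrite RintegralZl// -?momE//; apply: integrable_kern; lra.
have := @Rintegral_derive_itv0y _ (kern_bound n `|x| * (r + 1 + `|x|)) q
  (fun y => r * kern (r - 1) x y - kern (r + 1) x y + x * kern r x y)
  (kern r x) _ 0 q0 _ _ _ (cvg_kern_at0 _ x r0) (cvg_kern_aty _ x r0).
rewrite RintegralD//; last first.
  exact: (integrableB mE ik i1).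
rewrite RintegralB// Ik RintegralZl// -!momE => main.
have : r * mom (r - 1) x - mom (r + 1) x + x * mom r x =
    0 - (r == 0)%:R * expR (- (x ^+ 2 / 2)); last lra.
apply: main.
- move=> y y0.
  have k1 : kern (r + 1) x y <= kern_bound n `|x| * dom q y.
    by apply: kern_le_dom => //; lra.
  have k2 : kern r x y <= kern_bound n `|x| * dom q y.
    by apply: kern_le_dom => //; lra.
  have k3 : r * kern (r - 1) x y <= r * (kern_bound n `|x| * dom q y).
    have [->|rN0] := eqVneq r 0; first by rewrite !mul0r.
    apply: ler_wpM2l => //; apply: kern_le_dom => //; last lra.
    by rewrite /q (negbTE rN0).
  have n1 := kern_ge0 (r + 1) x y.
  have n3 := mulr_ge0 r0 (kern_ge0 (r - 1) x y).
  have n2 : `|x * kern r x y| <= `|x| * (kern_bound n `|x| * dom q y).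
    by rewrite normrM (ger0_norm (kern_ge0 _ _ _)) ler_wpM2l.
  rewrite (_ : _ * _ * dom q y = r * (kern_bound n `|x| * dom q y) +
    kern_bound n `|x| * dom q y + `|x| * (kern_bound n `|x| * dom q y)); last by ring.
  by move: n2; rewrite !ler_norml; lra.
- by move=> y; exact: is_derive_kern.
- move=> y y0; apply: cvgD; last first.
    by apply: cvgM; [exact: cvg_cst|exact: continuous_kern].
  apply: cvgB; last exact: continuous_kern.
  by apply: cvgM; [exact: cvg_cst|exact: continuous_kern].
Qed.

(** The minimum of the kernel over [[1, 2]], an interval of length 1, is a positive lower bound. *)
Lemma mom_gt0 {R : realType} (p x : R) : 0 < p + 1 -> 0 < mom p x.
Proof.
move=> p0.
have c12 : {within `[1, 2 : R], continuous (kern p x)}.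
  apply: continuous_in_subspaceT => y /set_mem; rewrite /= in_itv/= => /andP[y1 _].
  by apply: continuous_kern; lra.
have [|c] := EVT_min _ c12; first lra.
rewrite in_itv/= => /andP[c1 _] cmin.
have kc : 0 < kern p x c.
  by rewrite mulr_gt0 ?expR_gt0// powR_gt0//; lra.
have ik := integrable_kern p x p0.
have mE : measurable (`]0%R, +oo[%classic : set (measurableTypeR R)).
  exact: measurable_itv.
apply: (lt_le_trans kc); rewrite -lee_fin momE /Rintegral fineK; last first.
  exact: integrable_fin_num.
have -> : (kern p x c)%:E =
    (\int[@lebesgue_measure R]_(y in `[1%R, 2%R]) (kern p x c)%:E)%E.
  rewrite integral_cst//= lebesgue_measure_itv/= lte_fin.
  rewrite ifT; last lra.
  by rewrite -EFinB -EFinM; congr EFin; lra.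
have [mk _] := integrableP _ _ _ ik.
apply: (@le_trans _ _
    (\int[@lebesgue_measure R]_(y in `[1%R, 2%R]) (kern p x y)%:E)%E).
  apply: ge0_le_integral => //.
  - by move=> y _; rewrite lee_fin kern_ge0.
  - apply: measurable_funS mk => // y; rewrite /= !in_itv/= => /andP[y1 _].
    by rewrite andbT; lra.
apply: ge0_subset_integral => //.
- by move=> y _; rewrite lee_fin kern_ge0.
- move=> y; rewrite /= !in_itv/= => /andP[y1 _].
  by rewrite andbT; lra.
Qed.

(* With [m] the mean [mom (p + 1) x / mom p x], the product
   [(y - m) * (y `^ d - m `^ d)] is nonnegative for every [y > 0]. *)
Lemma mom_ratio_le {R : realType} (p d x : R) : 0 < p + 1 -> 0 <= d ->
  mom (p + 1) x * mom (p + d) x <= mom (p + d + 1) x * mom p x.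
Proof.
move=> p0 d0; have mE : measurable (`]0%R, +oo[%classic : set (measurableTypeR R)).
  exact: measurable_itv.
have M0 := mom_gt0 p x p0.
pose m := mom (p + 1) x / mom p x.
have m0 : 0 < m by rewrite divr_gt0// mom_gt0//; lra.
have i0 := integrable_kern p x p0.
have [i1 i2 i3] : [/\
    (@lebesgue_measure R).-integrable `]0, +oo[ (EFin \o kern (p + 1) x),
    (@lebesgue_measure R).-integrable `]0, +oo[ (EFin \o kern (p + d) x) &
    (@lebesgue_measure R).-integrable `]0, +oo[ (EFin \o kern (p + d + 1) x)].
  by split; apply: integrable_kern; lra.
have lhs : \int[@lebesgue_measure R]_(y in `]0, +oo[)
    (m `^ d * (kern (p + 1) x y - m * kern p x y)) = 0.
  rewrite RintegralZl//; last exact: (integrableB mE i1 (integrableZl mE m i0)).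
  rewrite RintegralB//; last exact: (integrableZl mE m i0).
  by rewrite RintegralZl// -!momE /m divfK ?gt_eqF// subrr mulr0.
have : m * mom (p + d) x <= mom (p + d + 1) x.
  rewrite -subr_ge0 -lhs !momE.
  rewrite -[X in _ - X]RintegralZl// -RintegralB//; last first.
    exact: (integrableZl mE m i2).
  apply: le_Rintegral => //.
  - exact: (integrableZl mE _ (integrableB mE i1 (integrableZl mE m i0))).
  - exact: (integrableB mE i3 (integrableZl mE m i2)).
  move=> y; rewrite /= in_itv/= andbT => y0.
  rewrite !kernS// (_ : kern (p + d) x y = y `^ d * kern p x y); last first.
    by rewrite /kern powRD ?(gt_eqF y0) ?implybT//; ring.
  rewrite -subr_ge0.
  rewrite (_ : _ - _ = kern p x y * ((y - m) * (y `^ d - m `^ d))); last by ring.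
  apply: mulr_ge0; first exact: kern_ge0.
  have pow_mono (s t : R) : 0 < s -> s <= t -> s `^ d <= t `^ d.
    by move=> s0 st; apply: ge0_ler_powR => //; rewrite nnegrE; lra.
  have [/[dup] ym /(pow_mono _ _ m0)|/ltW/[dup] ym /(pow_mono _ _ y0)] := leP m y.
    by move=> pm; apply: mulr_ge0; lra.
  by move=> pm; rewrite -mulrNN; apply: mulr_ge0; lra.
by rewrite /m mulrAC ler_pdivrMr.
Qed.

(** * Sign changes for the equation [f'' + x f' + a f = 0] *)

Lemma is_derive_gt0_lt {R : realType} (F F' : R -> R) :
  (forall x : R, is_derive x 1 F (F' x)) -> (forall x : R, 0 < x -> 0 < F' x) ->
  forall x y : R, 0 <= x -> x < y -> F x < F y.
Proof.
move=> dF F'0 x y x0 xy.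
have cF : {within `[x, y], continuous F}.
  apply: derivable_within_continuous => z _; by have [] := dF z.
have [c] := MVT xy (fun z _ => dF z) cF.
rewrite in_itv/= => /andP[xc cy] eqF.
by rewrite -subr_gt0 eqF mulr_gt0 ?subr_gt0// F'0// (le_lt_trans x0).
Qed.

Lemma is_derive_ge0_le {R : realType} (F F' : R -> R) :
  (forall x : R, is_derive x 1 F (F' x)) -> (forall x : R, 0 < x -> 0 <= F' x) ->
  forall x y : R, 0 <= x -> x < y -> F x <= F y.
Proof.
move=> dF F'0 x y x0 xy.
have cF : {within `[x, y], continuous F}.
  apply: derivable_within_continuous => z _; by have [] := dF z.
have [c] := MVT xy (fun z _ => dF z) cF.
rewrite in_itv/= => /andP[xc cy] eqF.
by rewrite -subr_ge0 eqF mulr_ge0 ?subr_ge0 ?(ltW xy)// F'0// (le_lt_trans x0).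
Qed.

Lemma is_derive_expR_sqr {R : realType} (x : R) :
  is_derive x 1 (fun t : R => expR (t ^+ 2 / 2)) (x * expR (x ^+ 2 / 2)).
Proof.
have du : is_derive x 1 (fun t : R => t ^+ 2 / 2) x.
  by apply: is_derive_eq; rewrite /GRing.scale/=; field.
have := @is_derive1_comp _ expR (fun t : R => t ^+ 2 / 2) _ _ _
  (is_derive_expR _) du.
by rewrite mulrC.
Qed.

(* [z = 0] is allowed: it occurs in the limit [l --> 0], where the sign
   change disappears into the origin. *)
Definition crosses {R : realType} (h : R -> R) (z : R) :=
  0 <= z /\ forall x, 0 < x -> Num.sg (h x) = Num.sg (x - z).

(** The equation in first-order form, with [g] for [f']. The slope condition admits both the
    reflected function (negative slope at 0) and the even one (zero slope). *)
Definition ode_sol {R : realType} (a : R) (f g : R -> R) :=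
  [/\ forall x : R, is_derive x 1 f (g x),
      forall x : R, is_derive x 1 g (- (x * g x + a * f x)),
      forall x, 0 < f x & g 0 <= 0].

(** The derivative of [expR (x ^+ 2 / 2) * f' x] is [- a * expR (x ^+ 2 / 2) * f x], which is
    negative. *)
Lemma ode_sol_deriv_lt0 {R : realType} (a : R) (f g : R -> R) : 0 < a ->
  ode_sol a f g -> forall x, 0 < x -> g x < 0.
Proof.
move=> a0 [df dg f0 g0] x x0.
have dG (t : R) : is_derive t 1 (fun t => - (expR (t ^+ 2 / 2) * g t))
    (expR (t ^+ 2 / 2) * (a * f t)).
  have := is_deriveN (is_deriveM (is_derive_expR_sqr t) (dg t)).
  by move=> /is_derive_eq; apply; rewrite /GRing.scale/=; ring.
have := is_derive_gt0_lt _ _ dG _ 0 x (lexx _) x0.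
rewrite ltrN2 => lt0.
have : expR (x ^+ 2 / 2) * g x < 0.
  apply: (lt_le_trans (lt0 _)); last by rewrite mulr_ge0_le0 ?expR_ge0.
  by move=> t _; rewrite !mulr_gt0 ?expR_gt0.
by rewrite pmulr_rlt0 ?expR_gt0.
Qed.

(* [expR (x ^+ 2 / 2) * f'' x] increases, its derivative being
   [- (1 + a) * expR (x ^+ 2 / 2) * f' x]; and a positive [f] cannot remain
   decreasing and concave. *)
Lemma ode_sol_crosses {R : realType} (a : R) (f g : R -> R) : 0 < a ->
  ode_sol a f g ->
  exists2 z, 0 < z & crosses (fun x => - (x * g x + a * f x)) z.
Proof.
move=> a0 sol; have g_lt0 := ode_sol_deriv_lt0 _ _ _ a0 sol.
case: sol => df dg f0 g0; pose h x := - (x * g x + a * f x).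
have dh (x : R) : is_derive x 1 h (- (g x + x * h x + a * g x)).
  have dx : is_derive x 1 (fun t : R => t) 1 by exact: is_derive_id.
  have := is_deriveN (is_deriveD (is_deriveM dx (dg x)) (is_deriveZ a (df x))).
  by move=> /is_derive_eq; apply; rewrite /h /GRing.scale/=; ring.
pose H x := expR (x ^+ 2 / 2) * h x.
have dH (x : R) : is_derive x 1 H (expR (x ^+ 2 / 2) * (- (1 + a) * g x)).
  have := is_deriveM (is_derive_expR_sqr x) (dh x).
  by move=> /is_derive_eq; apply; rewrite /GRing.scale/=; ring.
have Hlt : forall x y : R, 0 <= x -> x < y -> H x < H y.
  apply: is_derive_gt0_lt dH _ => x x0.
  by rewrite mulr_gt0 ?expR_gt0// nmulr_rgt0 ?g_lt0//; lra.
have sgH x : Num.sg (h x) = Num.sg (H x).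
  by rewrite /H sgrM (gtr0_sg (expR_gt0 _)) mul1r.
have g1 := g_lt0 1 ltr01; have f1 := f0 1.
have [c c1 hc] : exists2 c, 1 < c & 0 < h c.
  (* The tangent at 1 vanishes at [X], where [f] is still positive. So [g] exceeds [g 1] somewhere
     before [X], and a second use of the mean value theorem makes [g' = h] positive at some [c]. *)
  pose X := 1 - f 1 / g 1.
  have X1 : 1 < X.
    by rewrite /X ltrDl oppr_gt0 pmulr_rlt0// invr_lt0.
  have cf : {within `[1, X], continuous f}.
    by apply: derivable_within_continuous => z _; have [] := df z.
  have [d] := MVT X1 (fun z _ => df z) cf.
  rewrite in_itv/= => /andP[d1 dX] eqf.
  have gd : g 1 < g d.
    have : 0 < f X by [].
    have -> : f X = (g d - g 1) * (X - 1).
      have e1 : g 1 * (X - 1) = - f 1 by rewrite /X; field; rewrite lt_eqF.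
      by rewrite mulrBl e1 -eqf; ring.
    by rewrite pmulr_lgt0 ?subr_gt0.
  have cg : {within `[1, d], continuous g}.
    by apply: derivable_within_continuous => z _; have [] := dg z.
  have [c] := MVT d1 (fun z _ => dg z) cg.
  rewrite in_itv/= => /andP[c1 _] eqg; exists c => //.
  by move: gd; rewrite -subr_gt0 eqg pmulr_lgt0 ?subr_gt0.
have c0 : 0 < c by lra.
have ch : {within `[0, c], continuous h}.
  by apply: derivable_within_continuous => z _; have [] := dh z.
have h0 : h 0 < 0 by rewrite /h mul0r add0r oppr_lt0 mulr_gt0.
have [|z] := @IVT _ h 0 c 0 (ltW c0) ch.
  by rewrite ge_min le_max (ltW h0) (ltW hc) orbT.
rewrite in_itv/= => /andP[z0 _] hz.
have zgt0 : 0 < z.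
  rewrite lt_neqAle z0 andbT; apply/eqP => z0E.
  by move: h0; rewrite [in h 0]z0E hz ltxx.
exists z => //; split => // x x0; rewrite -/(h x) sgH.
have Hz : H z = 0 by rewrite /H hz mulr0.
have [xz|xz|->] := ltgtP x z.
- by rewrite !ltr0_sg ?subr_lt0// -Hz Hlt// ltW.
- by rewrite !gtr0_sg ?subr_gt0// -Hz Hlt.
- by rewrite Hz subrr.
Qed.

(* The Wronskian [W = f' F / a - F' f / b] satisfies
   [(expR (x ^+ 2 / 2) * W)' = expR (x ^+ 2 / 2) * f' * F' * (1 / a - 1 / b)]. *)
Lemma ode_sol_compare {R : realType} (a b : R) (f g F G : R -> R) :
  0 < a -> a < b -> ode_sol a f g -> ode_sol b F G -> g 0 = 0 -> G 0 = 0 ->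
  forall x, 0 < x -> x * g x + a * f x = 0 -> x * G x + b * F x <= 0.
Proof.
move=> a0 ab sf sF g0 G0 x x0 xfg; have b0 : 0 < b by exact: lt_trans ab.
have g_lt0 := ode_sol_deriv_lt0 _ _ _ a0 sf.
have G_lt0 := ode_sol_deriv_lt0 _ _ _ b0 sF.
case: sf sF => df dg _ _ [dF dG _ _].
pose W x := expR (x ^+ 2 / 2) * (a^-1 * (g x * F x) - b^-1 * (G x * f x)).
have dW (t : R) : is_derive t 1 W
    (expR (t ^+ 2 / 2) * (g t * G t * (a^-1 - b^-1))).
  have := is_deriveM (is_derive_expR_sqr t)
    (is_deriveB (is_deriveZ a^-1 (is_deriveM (dg t) (dF t)))
                (is_deriveZ b^-1 (is_deriveM (dG t) (df t)))).
  move=> /is_derive_eq; apply; rewrite /GRing.scale/=.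
  rewrite (_ : (a^-1 \*: (g * F) - b^-1 \*: (G * f)) t =
    a^-1 * (g t * F t) - b^-1 * (G t * f t))//.
  by field; rewrite !gt_eqF.
have : 0 <= W x.
  have <- : W 0 = 0 by rewrite /W g0 G0; ring.
  apply: (is_derive_ge0_le _ _ dW _ 0 x (lexx _) x0) => t t0.
  rewrite mulr_ge0 ?expR_ge0// mulr_ge0//.
    by rewrite ltW// nmulr_rgt0 ?G_lt0 ?g_lt0.
  by rewrite subr_ge0 lef_pV2 ?posrE// ltW.
(* At a zero of [f''] this substitution turns [W] into a positive multiple of [f' * (x F' + b F)],
   and [f' < 0] decides the sign. *)
have fE : f x = - (x * g x) / a.
  have e : a * f x = - (x * g x) by lra.
  by rewrite -e mulrC mulKf ?gt_eqF.
have -> : W x = expR (x ^+ 2 / 2) / (a * b) * (g x * (x * G x + b * F x)).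
  by rewrite /W fE; field; rewrite !gt_eqF.
rewrite pmulr_rge0; last by rewrite divr_gt0 ?expR_gt0// mulr_gt0.
by rewrite nmulr_rge0 ?g_lt0.
Qed.

Lemma crosses_inj {R : realType} (h : R -> R) (z x : R) : crosses h z ->
  0 < x -> h x = 0 -> x = z.
Proof.
move=> [z0 hz] x0 hx; have := hz _ x0.
by rewrite hx sgr0 => /esym/eqP; rewrite sgr_eq0 subr_eq0 => /eqP.
Qed.

Lemma crosses_lt {R : realType} (h : R -> R) (z x : R) : crosses h z ->
  0 < x -> (h x < 0) = (x < z).
Proof. by move=> [_ hz] x0; rewrite -sgr_lt0 hz// sgr_lt0 subr_lt0. Qed.

Lemma crosses_gt {R : realType} (h : R -> R) (z x : R) : crosses h z ->
  0 < x -> (0 < h x) = (z < x).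
Proof. by move=> [_ hz] x0; rewrite -sgr_gt0 hz// sgr_gt0 subr_gt0. Qed.

(** The signs of [h0] on either side of [z0] pass to [h t] by pointwise convergence and trap
    [z t]. *)
Lemma cvg_crosses {R : realType} {T : Type} (F : set_system T) {FF : Filter F}
    (h : T -> R -> R) (h0 : R -> R) (z : T -> R) (z0 : R) :
  (\forall t \near F, crosses (h t) (z t)) -> crosses h0 z0 ->
  (forall x : R, 0 < x -> h t x @[t --> F] --> h0 x) ->
  z t @[t --> F] --> z0.
Proof.
move=> hz hz0 hc; apply/cvgrPdist_lt => e e0.
have z00 : 0 <= z0 by case: hz0.
have near_lt : \forall t \near F, z t < z0 + e.
  have p : 0 < z0 + e by lra.
  have : 0 < h0 (z0 + e) by rewrite (crosses_gt _ _ _ hz0)//; lra.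
  move=> /(cvgr_gt _ (hc _ p)) hgt; near=> t.
  have ct : crosses (h t) (z t) by near: t.
  by rewrite -(crosses_gt _ _ _ ct)//; near: t.
have near_gt : \forall t \near F, z0 - e < z t.
  have [ze|ez] := ltP (z0 - e) 0.
    near=> t; have [zt0 _] : crosses (h t) (z t) by near: t.
    exact: lt_le_trans zt0.
  (* If [z0 = e], then [z0 - e] is the origin, where [crosses] prescribes no sign; half the distance
     keeps the test point positive. *)
  pose x := z0 - e / 2; have p : 0 < x by rewrite /x; lra.
  have : h0 x < 0 by rewrite (crosses_lt _ _ _ hz0)// /x; lra.
  move=> /(cvgr_lt _ (hc _ p)) hlt; near=> t.
  have ct : crosses (h t) (z t) by near: t.
  have : x < z t by rewrite -(crosses_lt _ _ _ ct)//; near: t.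
  by rewrite /x; lra.
near=> t; rewrite ltr_norml.
have : z t < z0 + e by near: t.
have : z0 - e < z t by near: t.
by lra.
Unshelve. all: by end_near. Qed.

(** * Derivatives of [phi] and the critical points *)

Lemma phi_mom {R : realType} (l : R) : phi l = mom (- (2 * l)).
Proof. by apply/funext => x; rewrite momE. Qed.

Definition dphi {R : realType} (a x : R) : R := mom (1 - a) x - x * mom (- a) x.

Definition ddphi {R : realType} (a x : R) : R :=
  - (x * dphi a x + a * mom (- a) x).

Lemma is_derive_mom_dphi {R : realType} (a x : R) : a < 1 ->
  is_derive x 1 (mom (- a)) (dphi a x).
Proof.
move=> a1; have := is_derive_mom (- a) x.
by rewrite [- a + 1]addrC; apply; lra.
Qed.

(** The differential equation originates here: by the recurrence at [1 - a], the derivative of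
    [mom (1 - a)] is [(1 - a) * mom (- a)]. *)
Lemma is_derive_dphi {R : realType} (a x : R) : a < 1 ->
  is_derive x 1 (dphi a) (ddphi a x).
Proof.
move=> a1; have dB : is_derive x 1 (mom (1 - a)) ((1 - a) * mom (- a) x).
  apply: (is_derive_eq (is_derive_mom (1 - a) x _)); first lra.
  rewrite mom_recurrence; last lra.
  rewrite (_ : (1 - a == 0) = false); last by rewrite gt_eqF// subr_gt0.
  by rewrite mul0r addr0 addrAC subrr add0r.
have dx : is_derive x 1 (fun t : R => t) 1 by exact: is_derive_id.
apply: (is_derive_eq (is_deriveB dB (is_deriveM dx (is_derive_mom_dphi a x a1)))).
by rewrite /ddphi /dphi /GRing.scale/=; ring.
Qed.

Lemma phi_derive1 {R : realType} (l : R) : 2 * l < 1 ->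
  (phi l)^`()%classic = dphi (2 * l).
Proof.
move=> l1; apply/funext => x; rewrite phi_mom derive1E.
by have [] := is_derive_mom_dphi _ x l1.
Qed.

Lemma phi_derive2 {R : realType} (l : R) : 2 * l < 1 ->
  (phi l)^`(2)%classic = ddphi (2 * l).
Proof.
move=> l1; rewrite /derive1n /= phi_derive1//; apply/funext => x; rewrite derive1E.
by have [] := is_derive_dphi _ x l1.
Qed.

Lemma is_derive_reflect {R : realType} (F F' : R -> R) (x : R) :
  (forall x : R, is_derive x 1 F (F' x)) ->
  is_derive x 1 (fun t => F (- t)) (- F' (- x)).
Proof.
move=> dF; have := @is_derive1_comp _ F (-%R) _ _ _ (dF (- x)) (is_deriveNid x 1).
by rewrite mulrN1.
Qed.

(** The equation is invariant under [x -> - x], which moves the negative zero of [phi''] to the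
    positive half-line. *)
Lemma ode_sol_reflect {R : realType} (a : R) : 0 < a < 1 ->
  ode_sol a (fun s => mom (- a) (- s)) (fun s => - dphi a (- s)).
Proof.
move=> /andP[a0 a1]; split=> [x|x|x|].
- by apply: is_derive_reflect => t; exact: is_derive_mom_dphi.
- have := is_deriveN (is_derive_reflect _ _ x (fun t => is_derive_dphi a t a1)).
  by move=> /is_derive_eq; apply; rewrite /ddphi; ring.
- by apply: mom_gt0; lra.
- by rewrite oppr0 /dphi mul0r subr0 oppr_le0 ltW// mom_gt0//; lra.
Qed.

Lemma ode_sol_even {R : realType} (a : R) : 0 < a < 1 ->
  ode_sol a (fun x => mom (- a) x + mom (- a) (- x))
    (fun x => dphi a x - dphi a (- x)).
Proof.
move=> /andP[a0 a1]; split=> [x|x|x|].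
- apply: is_deriveD; first exact: is_derive_mom_dphi.
  by apply: is_derive_reflect => t; exact: is_derive_mom_dphi.
- have := is_deriveB (is_derive_dphi a x a1)
    (is_derive_reflect _ _ x (fun t => is_derive_dphi a t a1)).
  by move=> /is_derive_eq; apply; rewrite /ddphi; ring.
- by rewrite addr_gt0// mom_gt0//; lra.
- by rewrite oppr0 subrr.
Qed.

(** A crossing at [s] makes the set defining [x1] the singleton of [- s], so [get] returns that
    point and not its default. *)
Lemma x1_crosses {R : realType} (l : R) : 0 < 2 * l < 1 ->
  0 < - x1 l /\ crosses (fun s => ddphi (2 * l) (- s)) (- x1 l).
Proof.
move=> /[dup] l01 /andP[l0 l1].
have [s s0 cs] := ode_sol_crosses _ _ _ l0 (ode_sol_reflect _ l01).
have {}cs : crosses (fun s => ddphi (2 * l) (- s)) s.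
  rewrite [X in crosses X](_ : _ = (fun s => - (s * - dphi (2 * l) (- s) +
    2 * l * mom (- (2 * l)) (- s))))//.
  by apply/funext => x; rewrite /ddphi; ring.
suff -> : x1 l = - s by rewrite opprK.
rewrite /x1 phi_derive2//; apply: get_unique => [|y] /=.
  split; first by rewrite oppr_lt0.
  by apply/eqP; rewrite -sgr_eq0 (proj2 cs)// subrr sgr0.
move=> [y0 hy]; rewrite -[y]opprK; congr (- _).
by apply: (crosses_inj _ _ _ cs); rewrite ?oppr_gt0// opprK.
Qed.

Lemma zpos_crosses {R : realType} (l : R) : 0 < 2 * l < 1 ->
  0 < zpos l /\
  crosses (fun x => ddphi (2 * l) x + ddphi (2 * l) (- x)) (zpos l).
Proof.
move=> /[dup] l01 /andP[l0 l1].
have [z z0 cz] := ode_sol_crosses _ _ _ l0 (ode_sol_even _ l01).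
have {}cz : crosses (fun x => ddphi (2 * l) x + ddphi (2 * l) (- x)) z.
  rewrite [X in crosses X](_ : _ = (fun x => - (x * (dphi (2 * l) x -
    dphi (2 * l) (- x)) + 2 * l * (mom (- (2 * l)) x + mom (- (2 * l)) (- x)))))//.
  by apply/funext => x; rewrite /ddphi; ring.
suff -> : zpos l = z by [].
rewrite /zpos phi_derive2//; apply: get_unique => [|y] /=.
  split=> //; by apply/eqP; rewrite -sgr_eq0 (proj2 cz)// subrr sgr0.
by move=> [y0 hy]; exact: (crosses_inj _ _ _ cz).
Qed.

(** * Monotonicity of the sign changes *)

(** Divided by [mom (- a) (- s)], [ddphi a (- s)] becomes [s * (mom (1 - a) (- s) / mom (- a) (- s))
    + s ^+ 2 - a]. The ratio of moments is nonincreasing in [a] by [mom_ratio_le], so the whole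
    strictly decreases. *)
Lemma ddphi_reflect_lt0 {R : realType} (a b s : R) : a < b -> b < 1 -> 0 < s ->
  ddphi a (- s) = 0 -> ddphi b (- s) < 0.
Proof.
move=> ab b1 s0; have := mom_ratio_le (- b) (b - a) (- s).
have : 0 < mom (- a) (- s) by apply: mom_gt0; lra.
have : 0 < mom (- b) (- s) by apply: mom_gt0; lra.
rewrite /ddphi /dphi (_ : - b + (b - a) = - a); last by ring.
rewrite ![- _ + 1]addrC.
move: (mom (- a) (- s)) (mom (- b) (- s)) (mom (1 - a) (- s)) (mom (1 - b) (- s)).
move=> A A' B B' A'0 A0 /(_ _ _) BA eq0.
have {}BA : B' * A <= B * A' by apply: BA; lra.
rewrite -(pmulr_rlt0 _ A0).
have -> : A * - (- s * (B' - - s * A') + b * A') =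
    s * (B' * A - B * A') + A' * - (- s * (B - - s * A) + a * A) - (b - a) * (A * A').
  by ring.
rewrite eq0 mulr0 addr0.
have p1 : 0 < (b - a) * (A * A') by rewrite !mulr_gt0// subr_gt0.
have : s * (B' * A - B * A') <= 0 by rewrite pmulr_rle0// subr_le0.
lra.
Qed.

Lemma x1_lt {R : realType} (l m : R) : 0 < 2 * l < 1 -> 0 < 2 * m < 1 -> l < m ->
  - x1 l < - x1 m.
Proof.
move=> l01 m01 lm; have [s0 cl] := x1_crosses l l01; have [_ cm] := x1_crosses m m01.
have <- := crosses_lt _ _ _ cm s0.
apply: (ddphi_reflect_lt0 (2 * l)) => //; [lra|lra|].
by apply/eqP; rewrite -sgr_eq0 (proj2 cl)// subrr sgr0.
Qed.

(** At [zpos l] the comparison of even solutions makes the sum for [m] nonnegative, so its sign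
    change has already occurred. For the quotient, strictness is supplied by [x1_lt]. *)
Lemma zpos_le {R : realType} (l m : R) : 0 < 2 * l < 1 -> 0 < 2 * m < 1 -> l < m ->
  zpos m <= zpos l.
Proof.
move=> l01 m01 lm; have [z0 cl] := zpos_crosses l l01; have [_ cm] := zpos_crosses m m01.
rewrite leNgt; have <- := crosses_lt _ _ _ cm z0.
have hl : ddphi (2 * l) (zpos l) + ddphi (2 * l) (- zpos l) = 0.
  by apply/eqP; rewrite -sgr_eq0 (proj2 cl)// subrr sgr0.
have l0 : 0 < 2 * l by lra.
have lm2 : 2 * l < 2 * m by lra.
have := ode_sol_compare _ _ _ _ _ _ l0 lm2
  (ode_sol_even _ l01) (ode_sol_even _ m01) _ _ _ z0.
move: hl; rewrite !oppr0 !subrr /ddphi => hl /(_ erefl erefl) cmp.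
by rewrite -leNgt; move: cmp; lra.
Qed.

(** * Limits of the sign changes *)

(* Equal to [(1 - a) * ddphi a x] for [a < 1], but also continuous at [a = 1],
   where [mom (- a) x] diverges. *)
Definition scaled_ddphi {R : realType} (a x : R) : R :=
  (x ^+ 2 - a) * (mom (2 - a) x - x * mom (1 - a) x) - (1 - a) * x * mom (1 - a) x.

(** The recurrence at [1 - a] trades [(1 - a) * mom (- a) x] for moments that stay finite at
    [a = 1]. *)
Lemma scaled_ddphiE {R : realType} (a x : R) : a < 1 ->
  scaled_ddphi a x = (1 - a) * ddphi a x.
Proof.
move=> a1; have := mom_recurrence (1 - a) x.
rewrite (_ : 1 - a == 0 = false); last by rewrite gt_eqF// subr_gt0.
rewrite (_ : 1 - a + 1 = 2 - a); last by ring.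
rewrite (_ : 1 - a - 1 = - a); last by ring.
rewrite mul0r addr0 /scaled_ddphi /ddphi /dphi => ->; last lra.
by ring.
Qed.

(** The recurrence at 1 reduces [mom 2] to lower moments; the one at 0 leaves only its Gaussian
    boundary term. *)
Lemma scaled_ddphi0 {R : realType} (x : R) :
  scaled_ddphi 0 x = - (x * expR (- (x ^+ 2 / 2))).
Proof.
have := mom_recurrence 1 x ler01; have := mom_recurrence 0 x (lexx _).
rewrite eqxx oner_eq0 add0r subrr !mul0r !mul1r add0r addr0 => <- e.
rewrite /scaled_ddphi !subr0 (_ : 2 = 1 + 1)// e.
by ring.
Qed.

Lemma scaled_ddphi1 {R : realType} (x : R) :
  scaled_ddphi 1 x = (x ^+ 2 - 1) * expR (- (x ^+ 2 / 2)).
Proof.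
have := mom_recurrence 0 x (lexx _).
rewrite eqxx add0r !mul0r !mul1r add0r => <-.
rewrite /scaled_ddphi subrr (_ : 2 - 1 = 1); last by ring.
by ring.
Qed.

(** The exponents [1 - 2 * l] and [2 - 2 * l] stay above [-1], so both endpoints [0] and [1 / 2] are
    covered. *)
Lemma continuous_scaled_ddphi {R : realType} (l x : R) : 2 * l < 2 ->
  {for l, continuous (fun l : R => scaled_ddphi (2 * l) x)}.
Proof.
move=> l2; have cm (k : R) : 1 <= k ->
    {for l, continuous (fun l : R => mom (k - 2 * l) x)}.
  move=> k1; apply: (@continuous_cvg _ _ _ _ _ (fun l : R => k - 2 * l)
      (fun p : R => mom p x)).
    by apply: continuous_mom; lra.
  apply: cvgB; first exact: cvg_cst.
  by apply: cvgM; first exact: cvg_cst.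
have c2 : (fun l : R => 2 * l) @ l --> 2 * l by apply: cvgM; first exact: cvg_cst.
have c1 : (fun l : R => 1 - 2 * l) @ l --> 1 - 2 * l by apply: cvgB => //; exact: cvg_cst.
apply: cvgB; apply: cvgM.
- by apply: cvgB => //; exact: cvg_cst.
- apply: cvgB; first by apply: cm; lra.
  by apply: cvgM; [exact: cvg_cst|apply: cm; lra].
- by apply: cvgM => //; exact: cvg_cst.
- by apply: cm; lra.
Qed.

Lemma crossesZ {R : realType} (c : R) (h : R -> R) (z : R) : 0 < c ->
  crosses h z -> crosses (fun x => c * h x) z.
Proof. by move=> c0 [z0 hz]; split=> // x /hz <-; rewrite sgrM gtr0_sg ?mul1r. Qed.

(** The limit profiles at [l = 1 / 2]: [c = 1] for the reflected function, [c = 2] for the even sum.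
    Both cross at 1, whence the limit 1 of [sigma]. *)
Lemma crosses_sqrB1 {R : realType} (c : R) (e : R -> R) : 0 < c ->
  (forall x, 0 < e x) -> crosses (fun x => c * ((x ^+ 2 - 1) * e x)) 1.
Proof.
move=> c0 e0; split=> // x x0.
rewrite sgrM (gtr0_sg c0) mul1r sgrM (gtr0_sg (e0 x)) mulr1.
rewrite (_ : x ^+ 2 - 1 = (x - 1) * (x + 1)); last by ring.
by rewrite sgrM (@gtr0_sg _ (x + 1)) ?mulr1// addr_gt0.
Qed.

Lemma scaled_crosses {R : realType} (l : R) : 0 < 2 * l < 1 ->
  crosses (fun s => scaled_ddphi (2 * l) (- s)) (- x1 l) /\
  crosses (fun x => scaled_ddphi (2 * l) x + scaled_ddphi (2 * l) (- x)) (zpos l).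
Proof.
move=> l01; have [/andP[_ l1] d0] : 0 < 2 * l < 1 /\ 0 < 1 - 2 * l by lra.
split.
  rewrite [X in crosses X](_ : _ = fun s => (1 - 2 * l) * ddphi (2 * l) (- s)).
    exact/crossesZ/(x1_crosses l l01).2.
  by apply/funext => s; rewrite scaled_ddphiE.
rewrite [X in crosses X](_ : _ = fun x =>
    (1 - 2 * l) * (ddphi (2 * l) x + ddphi (2 * l) (- x))).
  exact/crossesZ/(zpos_crosses l l01).2.
by apply/funext => x; rewrite !scaled_ddphiE// mulrDr.
Qed.

(** A general filter serves both the neighbourhoods of an interior [l] and the one-sided limits at
    the endpoints. *)
Lemma cvg_x1 {R : realType} (F : set_system R) (l s : R) : Filter F ->
  F --> l -> 2 * l < 2 -> (\forall t \near F, 0 < 2 * t < 1) ->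
  crosses (fun s => scaled_ddphi (2 * l) (- s)) s -> - x1 t @[t --> F] --> s.
Proof.
move=> FF Fl l2 Fi cs.
apply: (@cvg_crosses _ _ F FF (fun t s => scaled_ddphi (2 * t) (- s))) cs _.
  by near=> t; apply: (scaled_crosses _ _).1; near: t.
move=> x _; apply: cvg_trans (continuous_scaled_ddphi l (- x) l2).
exact: cvg_app Fl.
Unshelve. all: by end_near. Qed.

Lemma cvg_zpos {R : realType} (F : set_system R) (l z : R) : Filter F ->
  F --> l -> 2 * l < 2 -> (\forall t \near F, 0 < 2 * t < 1) ->
  crosses (fun x => scaled_ddphi (2 * l) x + scaled_ddphi (2 * l) (- x)) z ->
  zpos t @[t --> F] --> z.
Proof.
move=> FF Fl l2 Fi cz.
apply: (@cvg_crosses _ _ F FF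
  (fun t x => scaled_ddphi (2 * t) x + scaled_ddphi (2 * t) (- x))) cz _.
  by near=> t; apply: (scaled_crosses _ _).2; near: t.
move=> x _; apply: cvg_trans (cvgD (continuous_scaled_ddphi l x l2)
  (continuous_scaled_ddphi l (- x) l2)).
exact: cvg_app Fl.
Unshelve. all: by end_near. Qed.

Lemma ltr_le_div {R : realFieldType} (a b c d : R) :
  0 < a -> a < b -> 0 < d -> d <= c -> a / c < b / d.
Proof.
move=> a0 ab d0 dc; have c0 := lt_le_trans d0 dc.
rewrite ltr_pdivrMr// mulrAC ltr_pdivlMr//.
by apply: (le_lt_trans (ler_wpM2l (ltW a0) dc)); rewrite ltr_pM2r.
Qed.

Lemma ler_pV {R : realFieldType} (a b : R) : 0 < a -> a <= b -> b^-1 <= a^-1.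
Proof. by move=> a0 ab; rewrite lef_pV2 ?posrE// (lt_le_trans a0). Qed.

Theorem proposition3p10 (R : realType) :
  [/\ {in `]0, 1 / 2[, continuous (@sigma R)},
      {in `]0, 1 / 2[ &, {homo @sigma R : l m / l < m}},
      sigma l @[l --> (0 : R)^'+] --> (0 : R)
    & sigma l @[l --> (1 / 2 : R)^'-] --> (1 : R)].
Proof.
have itvE (l : R) : l \in `]0, 1 / 2[ -> 0 < 2 * l < 1.
  by rewrite in_itv/=; lra.
split.
- move=> l l_in; have l01 := itvE _ l_in.
  have near_l : \forall t \near l, 0 < 2 * t < 1.
    by apply: filterS (near_in_itvoo l_in) => t; exact: itvE.
  have [cs cz] := scaled_crosses l l01; have [z0 _] := zpos_crosses l l01.
  have l2 : 2 * l < 2 by lra.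
  apply: cvgM; first exact: (cvg_x1 _ l).
  by apply: cvgV; [rewrite gt_eqF|exact: (cvg_zpos _ l)].
- move=> l m /itvE l01 /itvE m01 lm.
  have [sl _] := x1_crosses l l01; have [zl _] := zpos_crosses l l01.
  have [zm _] := zpos_crosses m m01; have s_lt := x1_lt l m l01 m01 lm.
  have z_le := zpos_le l m l01 m01 lm.
  exact (ltr_le_div _ _ _ _ sl s_lt zm z_le).
- have near0 : \forall t \near (0 : R)^'+, 0 < 2 * t < 1.
    near=> t; have : 0 < t by near: t; exact: nbhs_right_gt.
    have : t < 1 / 2 by near: t; apply: nbhs_right_lt; lra.
    by lra.
  (* At [a = 0] the even sum vanishes identically and locates no limit of [zpos]. Monotonicity
     bounds [zpos t] below by [zpos (1 / 4)] instead, [1 / 4] being any fixed interior point. *)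
  have q01 : 0 < 2 * (1 / 4 : R) < 1 by lra.
  have [z0 _] := zpos_crosses (1 / 4) q01.
  apply: (@squeeze_cvgr _ _ _ _ (cst 0) (fun t => - x1 t / zpos (1 / 4))).
  + near=> t; have t01 : 0 < 2 * t < 1 by near: t.
    have tq : t < 1 / 4 by near: t; apply: nbhs_right_lt; lra.
    have [st _] := x1_crosses t t01; have [zt _] := zpos_crosses t t01.
    have z_le := zpos_le t (1 / 4) t01 q01 tq.
    apply/andP; split; first exact (ltW (divr_gt0 st zt)).
    exact (ler_wpM2l (ltW st) (ler_pV _ _ z0 z_le)).
  + exact: cvg_cst.
  rewrite -[X in _ --> X](mul0r (zpos (1 / 4))^-1).
  apply: cvgM; last exact: cvg_cst.
  apply: (cvg_x1 _ 0) => //; [exact: cvg_at_right_filter|lra|].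
  (* The limit profile [x * expR (- (x ^+ 2 / 2))] is positive on the half-line, that is, it crosses
     at 0. *)
  split=> // x x0.
  by rewrite mulr0 scaled_ddphi0 mulNr opprK subr0 !gtr0_sg// mulr_gt0 ?expR_gt0.
- have near1 : \forall t \near (1 / 2 : R)^'-, 0 < 2 * t < 1.
    near=> t; have : 0 < t by near: t; apply: nbhs_left_gt; lra.
    have : t < 1 / 2 by near: t; exact: nbhs_left_lt.
    by lra.
  have h2 : 2 * (1 / 2) < 2 :> R by lra.
  suff : sigma l @[l --> (1 / 2 : R)^'-] --> (1 / 1 : R) by rewrite divr1.
  apply: cvgM.
    apply: (cvg_x1 _ (1 / 2)) => //; first exact: cvg_at_left_filter.
    rewrite [X in crosses X](_ : _ = fun x =>
        1 * ((x ^+ 2 - 1) * expR (- (x ^+ 2 / 2)))); last first.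
      apply/funext => x; rewrite (_ : 2 * (1 / 2) = 1); last by field.
      by rewrite scaled_ddphi1 sqrrN mul1r.
    by apply: crosses_sqrB1 => // x; exact: expR_gt0.
  apply: cvgV; first exact: oner_neq0.
  apply: (cvg_zpos _ (1 / 2)) => //; first exact: cvg_at_left_filter.
  rewrite [X in crosses X](_ : _ = fun x =>
      2 * ((x ^+ 2 - 1) * expR (- (x ^+ 2 / 2)))); last first.
    apply/funext => x; rewrite (_ : 2 * (1 / 2) = 1); last by field.
    by rewrite !scaled_ddphi1 sqrrN; ring.
  by apply: crosses_sqrB1 => // x; exact: expR_gt0.
Unshelve. all: by end_near. Qed.
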